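(* Let $f:[0,1]\to[0,1]$ and $g:[0,1]\to[0,1]$ be derivatives. Then $f\circ g$ has a fixed point, i.e. there exists $x\in[0,1]$ with $f(g(x))=x$.
   Context: A function $f:[0,1]\to[0,1]$ is called a derivative if there is a differentiable function $F:[0,1]\to\mathbb{R}$ (one-sided differentiability at the endpoints) such that $F'(x)=f(x)$ for every $x\in[0,1]$. *)

(* Defs.v *)
(* MathComp-Analysis; R is an arbitrary realType. *)
From HB Require Import structures.
From mathcomp Require Export all_boot all_order all_algebra.
From mathcomp Require Export all_classical all_reals all_analysis.

Set Implicit Arguments.
Unset Strict Implicit.
Unset Printing Implicit Defensive.

Export Order.TTheory GRing.Theory Num.Theory.
Export numFieldNormedType.Exports.

Local Open Scope classical_set_scope.
Local Open Scope ring_scope.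

(* A function [0,1] -> R is encoded as a total function R -> R of which only
   the values on [0,1] matter. *)

Definition unit_selfmap (R : realType) (f : R -> R) : Prop :=
  forall x : R, x \in `[0, 1] -> f x \in `[0, 1].

(* The difference quotient is taken along the points of [0,1] other than x:
   two-sided when 0 < x < 1, one-sided at the endpoints 0 and 1. *)
Definition has_unit_derivative (R : realType) (F : R -> R) (x l : R) : Prop :=
  (F y - F x) / (y - x) @[y --> within `[0, 1] x^'] --> l.

Definition unit_derivative (R : realType) (f : R -> R) : Prop :=
  exists F : R -> R,
    forall x : R, x \in `[0, 1] -> has_unit_derivative F x (f x).

(* Main.v *)
Require Import Defs.
From mathcomp Require Import all_boot all_order all_algebra.
From mathcomp Require Import all_classical all_reals all_analysis.
From mathcomp Require Import ring lra.

(** A fixed point of [f o g] is a point [(x, y)] of the square with [g x = y]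
    and [f y = x], i.e. a zero of the discontinuous field
    [(g x - y, f y - x)].  If it has no zero, its rotation along any horizontal
    or vertical segment still makes sense, because each component changes sign
    exactly once along one family of segments, at a point where the other
    component is nonzero.  So every rectangle has a degree, which is additive
    under subdivision, and the degree of the whole square is 1.

    Say that a rectangle is essential if its degree is nonzero.  Each inequality
    [f y > x], [f y < x], [g x > y], [g x < y] holds on a countable union of the
    closed sets where the corresponding difference quotients are uniformly on
    the right side of [x] or [y] at scale [1/(n+1)].  Every essential rectangle
    contains an essential rectangle avoiding any given one of these closed sets;
    the intersection of a nested sequence of essential rectangles avoiding all
    of them would be a zero. *)

Import Order.TTheory GRing.Theory Num.Theory.
Local Open Scope ring_scope.

(** * Derivatives on the unit interval *)

Definition differentiates {R : realType} (F f : R -> R) : Prop :=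
  forall x e : R, 0 <= x <= 1 -> 0 < e ->
  exists2 d : R, 0 < d & forall y : R, 0 <= y <= 1 -> `|y - x| < d ->
    `|F y - F x - f x * (y - x)| <= e * `|y - x|.

Lemma differentiates_unit_derivative {R : realType} (f : R -> R) :
  unit_derivative f -> exists F, differentiates F f.
Proof.
move=> [F dF]; exists F => x e x01 e0.
have {}x01 : x \in `[0, 1] by rewrite in_itv.
have /cvgrPdist_le/(_ e e0) := dF x x01.
rewrite near_withinE near_withinE => /nbhs_ballP[d /= d0 H].
exists d => // y y01 yx.
have [->|yNx] := eqVneq y x; first by rewrite !subrr mulr0 subr0 normr0 mulr0.
have yx0 : y - x != 0 by rewrite subr_eq0.
have := H y; rewrite /ball /= distrC => /(_ yx yNx).
rewrite in_itv /= => /(_ y01) Hy.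
have -> : F y - F x - f x * (y - x) = - (f x - (F y - F x) / (y - x)) * (y - x).
  by field.
by rewrite normrM normrN ler_wpM2r.
Qed.

Lemma differentiates_scaleD {R : realType} (F f : R -> R) (s t : R) :
  differentiates F f -> differentiates (fun y => s * F y + t * y) (fun y => s * f y + t).
Proof.
move=> dF x e x01 e0.
have s0 : 0 < `|s| + 1 by rewrite ltr_wpDl.
have [d d0 H] := dF x (e / (`|s| + 1)) x01 (divr_gt0 e0 s0).
exists d => // y y01 /(H y y01) Hy.
have -> : s * F y + t * y - (s * F x + t * x) - (s * f x + t) * (y - x) =
  s * (F y - F x - f x * (y - x)) by ring.
rewrite normrM (le_trans (ler_wpM2l _ Hy)) // mulrA ler_wpM2r //.
by rewrite mulrA ler_pdivrMr // mulrC ler_wpM2l ?(ltW e0) // lerDl.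
Qed.

Lemma differentiates_rev {R : realType} (F f : R -> R) :
  differentiates F f -> differentiates (fun y => - F (1 - y)) (fun y => f (1 - y)).
Proof.
move=> dF x e x01 e0.
have x01' : 0 <= 1 - x <= 1 by lra.
have [d d0 H] := dF _ e x01' e0; exists d => // y y01 yx.
have /H : 0 <= 1 - y <= 1 by lra.
have -> : 1 - y - (1 - x) = - (y - x) by ring.
rewrite normrN => /(_ yx); congr (_ <= _).
by rewrite -normrN; congr (`|_|); ring.
Qed.

Lemma differentiates_continuous {R : realType} (F f : R -> R) (x e : R) :
  differentiates F f -> 0 <= x <= 1 -> 0 < e ->
  exists2 d : R, 0 < d & forall y : R, 0 <= y <= 1 -> `|y - x| < d -> `|F y - F x| < e.
Proof.
move=> dF x01 e0; have [d d0 H] := dF x 1 x01 ltr01.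
have s0 : 0 < `|f x| + 1 by rewrite ltr_wpDl.
exists (Num.min d (e / (`|f x| + 1))); first by rewrite lt_min d0 divr_gt0.
move=> y y01; rewrite lt_min => /andP[/(H y y01) Hy yx].
have -> : F y - F x = F y - F x - f x * (y - x) + f x * (y - x) by ring.
rewrite (le_lt_trans (ler_normD _ _)) // normrM.
rewrite (@le_lt_trans _ _ ((`|f x| + 1) * `|y - x|)) //; first lra.
by rewrite mulrC -ltr_pdivlMr.
Qed.

Lemma differentiates_is_derive {R : realType} (F f : R -> R) (x : R) :
  differentiates F f -> 0 < x < 1 -> is_derive x 1 F (f x).
Proof.
move=> dF x01.
suff H : (h^-1 *: (F (h *: 1 + x) - F x) @[h --> 0^'] --> f x)%classic.
  by apply: DeriveDef; [apply: cvgP H|apply: cvg_lim].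
apply/cvgrPdist_le => e e0.
have x01' : 0 <= x <= 1 by lra.
have [d d0 H] := dF x e x01' e0.
apply/nbhs_ballP; exists (Num.min d (Num.min x (1 - x))).
  by rewrite /= !lt_min d0; lra.
move=> h; rewrite /ball /= sub0r normrN !lt_min => /and3P[hd hx h1] h0.
have hh : h \is a GRing.unit by rewrite unitfE.
have y01 : 0 <= h *: 1 + x <= 1.
  by move: hx h1; rewrite !ltr_norml /GRing.scale /= mulr1; lra.
have yx : h *: 1 + x - x = h by rewrite addrK /GRing.scale /= mulr1.
have := H _ y01; rewrite yx => /(_ hd).
have -> : F (h *: 1 + x) - F x - f x * h =
  - (f x - h^-1 *: (F (h *: 1 + x) - F x)) * h.
  by rewrite /GRing.scale /= mulr1; field.
by rewrite normrM normrN ler_pM2r // normr_gt0.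
Qed.

(** * The set where a derivative is nonpositive *)

Lemma derivative_le0_endpoint {R : realType} (F f : R -> R) (l r : R) :
  differentiates F f -> 0 <= l -> l < r -> r <= 1 ->
  (forall y : R, l < y <= r -> f y <= 0) -> f l <= 0.
Proof.
move=> dF l0 lr r1 H; rewrite leNgt; apply/negP => fl0.
have l01 : 0 <= l <= 1 by lra.
have f2 : 0 < f l / 2 by lra.
have [d d0 Hd] := dF l (f l / 2) l01 f2.
pose y := Num.min r (l + d / 2).
have yr : y <= r by rewrite /y ge_min lexx.
have yd : y <= l + d / 2 by rewrite /y ge_min lexx orbT.
have ly : l < y by rewrite /y lt_min lr; lra.
have y01 : 0 <= y <= 1 by lra.
have yl : `|y - l| = y - l by rewrite ger0_norm; lra.
have := Hd y y01; rewrite yl => /(_ ltac:(lra)); rewrite ler_norml => /andP[Hy _].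
(* Differentiability at [l] forces a mean slope of at least [f l / 2] on [[l, y]], while the mean
   value theorem makes it [f c <= 0]. *)
have [||c] := @MVT R F f l y ly.
- by move=> x; rewrite in_itv /= => xly; apply: differentiates_is_derive => //; lra.
- apply/subspace_continuousP => x; rewrite /= in_itv /= => xly.
  apply/cvgrPdist_lt => e e0; rewrite near_withinE.
  have x01 : 0 <= x <= 1 by lra.
  have [k k0 Hk] := @differentiates_continuous R F f x e dF x01 e0.
  apply/nbhs_ballP; exists k => // w; rewrite /ball /= distrC => wk.
  by rewrite in_itv /= => wly; rewrite distrC; apply: Hk => //; lra.
- rewrite in_itv /= => cly cE.
  have fc : f c <= 0 by apply: H; lra.
  have := mulr_le0_ge0 fc (ltW (_ : 0 < y - l)); rewrite -cE => /(_ ltac:(lra)).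
  have := mulr_gt0 f2 (_ : 0 < y - l) => /(_ ltac:(lra)).
  lra.
Qed.

(* [Y] misses the component of [{f <= 0}] containing [y], which is closed because
   a derivative cannot jump, and [Y] also misses a neighborhood of its left end
   point. *)
Lemma left_gap {R : realType} (F f : R -> R) (Y : R -> Prop) (c y : R) :
  differentiates F f ->
  (forall x : R, 0 <= x <= 1 -> f x <= 0 ->
    exists2 e : R, 0 < e & forall z : R, `|z - x| < e -> ~ Y z) ->
  0 <= c -> c <= y -> y <= 1 -> f y <= 0 ->
  exists2 w : R, c <= w <= y & (w = c \/ 0 < f w) /\ forall z : R, w <= z <= y -> ~ Y z.
Proof.
move=> dF HY c0 cy y1 fy.
have nY (z : R) : 0 <= z <= 1 -> f z <= 0 -> ~ Y z.
  by move=> z01 /(HY z z01)[e e0]; apply; rewrite subrr normr0.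
pose T := [set t | c <= t <= y /\ forall z, t <= z <= y -> f z <= 0]%classic.
have Ty : T y.
  split=> [|z zy]; first lra.
  by have -> : z = y by lra.
have lbT : has_lbound T by exists c => t [] /andP[].
pose l := inf T.
have ly : l <= y by apply: ge_inf.
have cl : c <= l by apply: lb_le_inf; [exists y|move=> t [] /andP[]].
have lz (z : R) : l < z <= y -> f z <= 0.
  move=> /andP[lz zy]; have [t [_ Tt] tz] := inf_lt (ex_intro _ y Ty) lz.
  by apply: Tt; lra.
have fl : f l <= 0.
  have [->//|ly'] := eqVneq l y.
  by apply: (derivative_le0_endpoint F f l y) => //; lra.
have lez (z : R) : l <= z <= y -> f z <= 0.
  move=> zly; have [->//|zl] := eqVneq z l.
  by apply: lz; lra.
have l01 : 0 <= l <= 1 by lra.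
have [e e0 He] := HY l l01 fl.
pose w0 := Num.max c (l - e / 2).
have cw0 : c <= w0 by rewrite /w0 le_max lexx.
have lw0 : l - e / 2 <= w0 by rewrite /w0 le_max lexx orbT.
have w0l : w0 <= l by rewrite /w0 ge_max cl; lra.
(* Either a positive value occurs within [e] of [l], where [Y] is absent, or [w0] lies in [T], so
   [w0 = l], which is possible only if [l = c]. *)
have [[z [zw fz]]|N] := pselect (exists z, w0 <= z <= y /\ 0 < f z).
  have zl : z < l by rewrite ltNge; apply/negP => zl; have := lez z; lra.
  exists z; first lra.
  split=> [|x xz]; first by right.
  have [xl|lx] := ltP x l; last by apply: nY; [|apply: lez]; lra.
  by apply: He; rewrite ltr_norml; lra.
have Tw : T w0.
  split=> [|z zw]; first lra.
  by rewrite leNgt; apply/negP => fz; apply: N; exists z.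
have lw : l <= w0 by apply: ge_inf.
have cE : c = l.
  by move: lw; rewrite /w0 le_max => /orP[]; lra.
exists c; first lra.
split=> [|z zc]; first by left.
by apply: nY; [|apply: lez]; lra.
Qed.

Lemma right_gap {R : realType} (F f : R -> R) (Y : R -> Prop) (d y : R) :
  differentiates F f ->
  (forall x : R, 0 <= x <= 1 -> f x <= 0 ->
    exists2 e : R, 0 < e & forall z : R, `|z - x| < e -> ~ Y z) ->
  0 <= y -> y <= d -> d <= 1 -> f y <= 0 ->
  exists2 w : R, y <= w <= d & (w = d \/ 0 < f w) /\ forall z : R, y <= z <= w -> ~ Y z.
Proof.
move=> dF HY y0 yd d1 fy.
have := left_gap _ _ (fun z => Y (1 - z)) (1 - d) (1 - y) (differentiates_rev _ _ dF).
case; try lra.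
- move=> x x01 fx; have [|e e0 He] := HY (1 - x) _ fx; first lra.
  exists e => // z zx; apply: He.
  by rewrite (_ : 1 - z - (1 - x) = - (z - x)) ?normrN //; ring.
- by rewrite (_ : 1 - (1 - y) = y) //; ring.
move=> w wy [ww wY]; exists (1 - w); first lra.
split.
  by case: ww => [->|]; [left; ring|right].
move=> z zy; rewrite -(_ : 1 - (1 - z) = z); last by ring.
by apply: wY; lra.
Qed.

(** Here [m] models the degree of horizontal strips, and [p], [q] the heights where [g] meets the
    vertical sides. A counted crossing sits where [f <= 0], hence inside an interval on which [m]
    vanishes, so the crossings must cancel; end levels with [f <= 0] are cut off by such
    intervals. *)
Lemma strip_mass_eq0 {R : realType} (F f : R -> R) (Y : R -> Prop)
    (m : R -> R -> int) (c d p q : R) (P Q : bool) :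
  differentiates F f ->
  (forall x : R, 0 <= x <= 1 -> f x <= 0 ->
    exists2 e : R, 0 < e & forall z : R, `|z - x| < e -> ~ Y z) ->
  0 <= c -> c <= d -> d <= 1 ->
  (forall s t u : R, m s u = m s t + m t u) ->
  (forall s t : R, c <= s -> s <= t -> t <= d ->
    (forall z, s <= z <= t -> ~ Y z) -> m s t = 0) ->
  (P -> c <= p <= d -> f p <= 0) -> (Q -> c <= q <= d -> f q <= 0) ->
  (forall s t : R, c <= s -> s <= t -> t <= d -> 0 < f s -> 0 < f t ->
    m s t = (Q && (s <= q < t))%:Z - (P && (s <= p < t))%:Z) ->
  m c d = 0.
Proof.
move=> dF HY c0 cd d1 mD m0 fp fq mE.
(* The component of [{f <= 0}] containing [p'] is squeezed between levels [w] and
   [v] where [f > 0] and between which [m] vanishes, so [q'] is caught there too. *)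
have half (p' q' : R) (P' Q' : bool) (s t : R) :
    (P' -> c <= p' <= d -> f p' <= 0) ->
    (forall s t : R, c <= s -> s <= t -> t <= d -> 0 < f s -> 0 < f t ->
      m s t = 0 -> (Q' && (s <= q' < t)) = (P' && (s <= p' < t))) ->
    c <= s -> s <= t -> t <= d -> 0 < f s -> 0 < f t ->
    P' && (s <= p' < t) -> Q' && (s <= q' < t).
  move=> fp' E cs st td fs ft /andP[P'1 /andP[sp pt]].
  have {}fp' : f p' <= 0 by apply: fp' => //; lra.
  have [| | |w wp [ww wY]] := left_gap F f Y s p' dF HY _ _ _ fp'; try lra.
  have [| | |v vp [vv vY]] := right_gap F f Y t p' dF HY _ _ _ fp'; try lra.
  have fw : 0 < f w by case: ww => [->|].
  have fv : 0 < f v by case: vv => [->|].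
  have pv : p' < v.
    rewrite lt_neqAle; apply/andP; split; last lra.
    by apply/eqP => pv; move: fv; rewrite -pv; lra.
  have mwv : m w v = 0.
    apply: m0; try lra.
    by move=> z zz; have [zp|pz] := leP z p'; [apply: wY|apply: vY]; lra.
  have := E w v ltac:(lra) ltac:(lra) ltac:(lra) fw fv mwv.
  rewrite P'1 /= => EQ; have : Q' && (w <= q' < v) by rewrite EQ; lra.
  by case/andP => -> /=; lra.
have m_eq0 (s t : R) : c <= s -> s <= t -> t <= d -> 0 < f s -> 0 < f t ->
    m s t = 0 -> (Q && (s <= q < t)) = (P && (s <= p < t)).
  by move=> cs st td fs ft; rewrite mE //; case: (Q && _); case: (P && _).
have pos (s t : R) : c <= s -> s <= t -> t <= d -> 0 < f s -> 0 < f t -> m s t = 0.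
  move=> cs st td fs ft; rewrite mE //.
  suff -> : Q && (s <= q < t) = (P && (s <= p < t)) by rewrite subrr.
  by apply/idP/idP; apply: half => // s' t' *; rewrite m_eq0.
have posl (s : R) : c <= s -> s <= d -> 0 < f s -> m s d = 0.
  move=> cs sd fs; have [fd|fd] := ltP 0 (f d); first exact: pos.
  have [| | |w ws [ww wY]] := left_gap F f Y s d dF HY _ _ _ fd; try lra.
  have fw : 0 < f w by case: ww => [->|].
  by rewrite (mD s w) pos ?m0 //; lra.
have [fc|fc] := ltP 0 (f c); first exact: posl.
have [| | |w ws [ww wY]] := right_gap F f Y d c dF HY _ _ _ fc; try lra.
have mcw : m c w = 0 by apply: m0 => //; lra.
rewrite (mD c w) mcw add0r; case: ww => [wd|fw]; last by apply: posl; lra.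
(* Additivity at [d], [d], [d] gives [m d d = 0]. *)
by apply: (addrI (m d d)); rewrite wd addr0 -mD.
Qed.

(** * Scales and uniformly steep points *)

Lemma ltr_invn_exists {R : realType} (e : R) : 0 < e -> exists n : nat, n.+1%:R^-1 < e.
Proof.
move=> e0; exists (Num.bound e^-1).
have e0' : 0 <= e^-1 by rewrite invr_ge0 ltW.
rewrite invf_plt ?posrE ?ltr0Sn // (lt_trans (archi_boundP e0')) //.
by rewrite ltr_nat.
Qed.

(** A single test point [w] at distance [k] from [x] already violates steepness at [x], by a margin
    of [delta / 2 * k ^+ 2]; continuity of [F] carries the violation to nearby [z]. *)
Lemma steep_near {R : realType} (F f : R -> R) (x delta eta : R) :
  differentiates F f -> 0 <= x <= 1 -> f x <= 0 -> 0 < delta -> 0 < eta ->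
  exists2 e : R, 0 < e & forall z : R, `|z - x| < e ->
    ~ (0 <= z <= 1 /\ forall w : R, 0 <= w <= 1 -> `|w - z| < eta ->
         delta * (w - z) ^+ 2 <= (F w - F z) * (w - z)).
Proof.
move=> dF x01 fx delta0 eta0.
have d2 : 0 < delta / 2 by lra.
have [d d0 Hd] := dF x _ x01 d2.
(* The bound [1 / 4] keeps [x + k] or [x - k] inside [[0, 1]]. *)
pose k := Num.min (1 / 4) (Num.min (d / 2) (eta / 2)).
have k0 : 0 < k by rewrite !lt_min; do ?(apply/andP; split); lra.
have k4 : k <= 1 / 4 by rewrite ge_min lexx.
have kd : k <= d / 2 by rewrite !ge_min lexx orbT.
have ke : k <= eta / 2 by rewrite !ge_min lexx !orbT.
have [w w01 wk] : exists2 w, 0 <= w <= 1 & `|w - x| = k.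
  have [x2|x2] := leP x (1 / 2).
    by exists (x + k); [lra|rewrite addrAC subrr add0r gtr0_norm].
  by exists (x - k); [lra|rewrite addrAC subrr add0r normrN gtr0_norm].
have := Hd w w01; rewrite wk => /(_ ltac:(lra)) Hw.
set A := F w - F x in Hw; set B := w - x in wk Hw.
have BB : B ^+ 2 = k ^+ 2 by rewrite -wk real_normK ?num_real.
have AB : A * B <= delta / 2 * k ^+ 2.
  have : (A - f x * B) * B <= delta / 2 * k ^+ 2.
    by rewrite expr2 mulrA (le_trans (ler_norm _)) // normrM wk ler_wpM2r // ltW.
  have : f x * k ^+ 2 <= 0 by rewrite mulr_le0_ge0 // sqr_ge0.
  by rewrite -BB; lra.
have k2 : 0 < delta / 2 * k ^+ 2 by rewrite mulr_gt0 // exprn_gt0.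
(* [rho * M] bounds the total error of moving the base point from [x] to [z]; the summand [2], where
   [1] would bound it, makes the final contradiction strict. *)
pose M := k + `|A| + 2 + 2 * delta * k.
have dk : 0 < delta * k by rewrite mulr_gt0.
have M0 : 0 < M by rewrite /M; have := normr_ge0 A; lra.
pose rho := Num.min 1 (Num.min (eta / 2) (delta / 2 * k ^+ 2 / M)).
have rho0 : 0 < rho by rewrite !lt_min ltr01 (divr_gt0 k2 M0) andbT; lra.
have rho1 : rho <= 1 by rewrite ge_min lexx.
have rhoe : rho <= eta / 2 by rewrite !ge_min lexx orbT.
have rhoM : rho * M <= delta / 2 * k ^+ 2.
  by rewrite -ler_pdivlMr // !ge_min lexx !orbT.
have [e e0 He] := differentiates_continuous F f x rho dF x01 rho0.
exists (Num.min e rho); first by rewrite lt_min e0.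
move=> z; rewrite lt_min => /andP[ze zr] [z01 /(_ w w01)].
have -> : w - z = B - (z - x) by rewrite /B; ring.
have -> : F w - F z = A - (F z - F x) by rewrite /A; ring.
have := He z z01 ze; move: zr; move: (z - x) (F z - F x) => v u vr ur.
have Bve : `|B - v| < eta by rewrite (le_lt_trans (ler_normB _ _)) // wk; lra.
move=> /(_ Bve) H.
have uB : `|u * B| <= rho * k by rewrite normrM wk ler_pM2r // ltW.
have vA : `|A * v| <= rho * `|A| by rewrite normrM mulrC ler_wpM2r // ltW.
have uv : `|u * v| <= rho * 1 by rewrite normrM ler_pM // ltW // (lt_le_trans vr).
have Bv : `|delta * (B * v)| <= rho * (delta * k).
  by rewrite !normrM wk (gtr0_norm delta0) mulrA mulrC ler_pM2r // ltW.
have vv : 0 <= delta * v ^+ 2 by rewrite mulr_ge0 ?sqr_ge0 // ltW.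
move: uB vA uv Bv; rewrite !ler_norml => /andP[uB _] /andP[vA _] /andP[_ uv] /andP[_ Bv].
have rM : rho * M = rho * k + rho * `|A| + rho * 2 + 2 * (rho * (delta * k)).
  by rewrite /M; ring.
have EB : (B - v) ^+ 2 = B ^+ 2 - 2 * (B * v) + v ^+ 2 by ring.
have EA : (A - u) * (B - v) = A * B - A * v - u * B + u * v by ring.
have {}H : delta * k ^+ 2 - 2 * (delta * (B * v)) + delta * v ^+ 2
    <= A * B - A * v - u * B + u * v.
  by rewrite -EA (le_trans _ H) // EB -BB; lra.
clear -H uB vA uv Bv vv rM rhoM AB rho0; lra.
Qed.

(** * Rectangles and their degree *)

Record rect (R : realType) := Rect { xl : R; xr : R; yl : R; yr : R }.
Arguments Rect {R}.
Arguments xl {R}.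
Arguments xr {R}.
Arguments yl {R}.
Arguments yr {R}.

(** Exchanging the coordinates exchanges [f] and [g], so avoidance is proved for [f] alone. *)
Definition flip {R : realType} (r : rect R) := Rect (yl r) (yr r) (xl r) (xr r).

Definition in_rect {R : realType} (r : rect R) (x y : R) :=
  (xl r <= x <= xr r) && (yl r <= y <= yr r).

Definition subrect {R : realType} (r' r : rect R) :=
  [&& xl r <= xl r', xr r' <= xr r, yl r <= yl r' & yr r' <= yr r].

(* Lift the angle of [(g x - y, f y - x)] along the vertical line through
   [(x, y)], starting in the right half-plane below the graph of [g], and along
   the horizontal one, starting in the upper half-plane left of the graph of
   [f].  Both lifts are angles of the same vector, and [turn] is the number of
   full turns by which the second exceeds the first. *)
Definition turn {R : realType} (f g : R -> R) (x y : R) : int :=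
  ((f y < x) && (g (f y) < y))%:Z + ((g x < y) && (f (g x) < x))%:Z
  - ((g x < y) && (f y < x))%:Z.

(** When [f o g] has no fixed point, this is the clockwise rotation of the field around the
    boundary, in full turns: the lifts along the sides telescope to their mismatches [turn] at the
    corners. *)
Definition degree {R : realType} (f g : R -> R) (r : rect R) : int :=
  turn f g (xr r) (yr r) - turn f g (xl r) (yr r)
  - turn f g (xr r) (yl r) + turn f g (xl r) (yl r).

Definition essential {R : realType} (f g : R -> R) (r : rect R) :=
  [/\ 0 <= xl r <= xr r, xr r <= 1, 0 <= yl r <= yr r, yr r <= 1 & degree f g r != 0].

Lemma turn_flip {R : realType} (f g : R -> R) (x y : R) :
  turn g f y x = turn f g x y.
Proof. by rewrite /turn; congr (_ - _); [exact: addrC|rewrite andbC]. Qed.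

Lemma turn_left {R : realType} (f g : R -> R) (x y : R) : x <= f y ->
  turn f g x y = ((f (g x) < x) && (g x < y))%:Z.
Proof. by rewrite leNgt /turn => /negbTE ->; rewrite andbF subr0 add0r andbC. Qed.

(** The first term is independent of [x], so it cancels in the degree. *)
Lemma turn_right {R : realType} (f g : R -> R) (x y : R) : f y < x ->
  turn f g x y = (g (f y) < y)%R%:Z - ((x <= f (g x)) && (g x < y))%:Z.
Proof.
rewrite /turn => ->; rewrite andbT leNgt.
by case: (f (g x) < x); case: (g x < y); case: (g (f y) < y).
Qed.

Lemma crossing_count {R : realType} (P : bool) (q s t : R) : s <= t ->
  (P && (s <= q < t))%:Z = (P && (q < t))%:Z - (P && (q < s))%:Z.
Proof.
move=> st; case: P => //=; rewrite leNgt.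
by have [qs|] := ltP q s; [rewrite (lt_le_trans qs)|case: (q < t)].
Qed.

Lemma degree_flip {R : realType} (f g : R -> R) (r : rect R) :
  degree g f (flip r) = degree f g r.
Proof. by rewrite /degree /= !(turn_flip f g); ring. Qed.

Lemma essential_flip {R : realType} (f g : R -> R) (r : rect R) :
  essential f g r -> essential g f (flip r).
Proof. by case=> *; split => //; rewrite degree_flip. Qed.

Lemma subrect_trans {R : realType} (r3 r2 r1 : rect R) :
  subrect r3 r2 -> subrect r2 r1 -> subrect r3 r1.
Proof. by rewrite /subrect => /and4P[? ? ? ?] /and4P[? ? ? ?]; lra. Qed.

Lemma subrect_refl {R : realType} (r : rect R) : subrect r r.
Proof. by rewrite /subrect; lra. Qed.

(** [turn] vanishes at the three corners with a zero coordinate. At [(1, 1)] the absence of fixed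
    points reduces it to the indicator of [f 1 < 1] or [g 1 < 1], and one of these holds since
    otherwise [1] would be fixed. *)
Lemma degree_unit {R : realType} (f g : R -> R) :
  unit_selfmap f -> unit_selfmap g ->
  (forall x : R, 0 <= x <= 1 -> f (g x) <> x) -> degree f g (Rect 0 1 0 1) = 1.
Proof.
move=> f01 g01 nofix.
have F (x : R) : 0 <= x <= 1 -> 0 <= f x <= 1.
  by move=> x01; have := f01 x; rewrite !in_itv /=; apply.
have G (x : R) : 0 <= x <= 1 -> 0 <= g x <= 1.
  by move=> x01; have := g01 x; rewrite !in_itv /=; apply.
have c0 : 0 <= (0 : R) <= 1 by apply/andP.
have c1 : 0 <= (1 : R) <= 1 by apply/andP.
have ng0 (x : R) : 0 <= x <= 1 -> (g x < 0) = false by move=> /G ?; lra.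
have nf0 (x : R) : 0 <= x <= 1 -> (f x < 0) = false by move=> /F ?; lra.
have F1 := F 1 c1; have G1 := G 1 c1; have G0 := G 0 c0; have F0 := F 0 c0.
have ng0' := ng0 _ F0; have nf0' := nf0 _ G0.
have gf : f 1 < 1 -> g (f 1) < 1.
  move=> lf; have := G _ F1; rewrite lt_neqAle => /andP[_ ->]; rewrite andbT.
  by apply/eqP => E; apply: (nofix (f 1)) => //; rewrite E.
have fg : g 1 < 1 -> f (g 1) < 1.
  move=> lf; have := F _ G1; rewrite lt_neqAle => /andP[_ ->]; rewrite andbT.
  by apply/eqP => E; apply: (nofix 1).
have n1 : (f 1 < 1) || (g 1 < 1).
  apply/negPn; rewrite negb_or -!leNgt; apply/negP => /andP[f1 g1].
  apply: (nofix 1) => //; have -> : g 1 = 1 by lra.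
  lra.
rewrite /degree /turn /= ?ng0 // ?nf0 // ?ng0' ?nf0' ?andbF /=.
by move: gf fg n1; case: (f 1 < 1); case: (g 1 < 1) => //= gf fg _; rewrite ?gf ?fg.
Qed.

Lemma degree_addy {R : realType} (f g : R -> R) (a b s t u : R) :
  degree f g (Rect a b s u) = degree f g (Rect a b s t) + degree f g (Rect a b t u).
Proof. by rewrite /degree /=; ring. Qed.

Lemma degree_addx {R : realType} (f g : R -> R) (a m b c d : R) :
  degree f g (Rect a b c d) = degree f g (Rect a m c d) + degree f g (Rect m b c d).
Proof. by rewrite /degree /=; ring. Qed.

(** * Essential subrectangles avoiding a slope condition *)

Lemma essential_halvex {R : realType} (f g : R -> R) (r : rect R) :
  essential f g r -> exists r', [/\ essential f g r', subrect r' r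
    & xr r' - xl r' = (xr r - xl r) / 2].
Proof.
case: r => a b c d [/= ab b1 cd d1 N].
pose m := (a + b) / 2.
have [mE|N'] := eqVneq (degree f g (Rect a m c d)) 0.
  exists (Rect m b c d); split; last by rewrite /m /=; lra.
  - split=> //=; [by rewrite /m; lra|].
    by move: N; rewrite (degree_addx _ _ _ m) mE add0r.
  - by rewrite /subrect /= /m; lra.
exists (Rect a m c d); split; last by rewrite /m /=; lra.
- by split=> //=; rewrite /m; lra.
- by rewrite /subrect /= /m; lra.
Qed.

Lemma essential_shrinkx {R : realType} (f g : R -> R) (r : rect R) (e : R) :
  essential f g r -> 0 < e ->
  exists r', [/\ essential f g r', subrect r' r & xr r' - xl r' < e].
Proof.
move=> ess e0; have [n ne] := ltr_invn_exists e e0.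
suff [r' [ess' sub' r'n]] : exists r', [/\ essential f g r', subrect r' r
    & xr r' - xl r' <= n.+1%:R^-1].
  by exists r'; split => //; apply: le_lt_trans ne.
elim: n {ne} => [|n [r1 [ess1 sub1 r1n]]].
  exists r; split => //; first exact: subrect_refl.
  by case: ess => *; rewrite invr1; lra.
have [r2 [ess2 sub2 r2E]] := essential_halvex f g r1 ess1.
exists r2; split => //; first exact: subrect_trans sub2 sub1.
rewrite r2E; apply: le_trans (_ : n.+1%:R^-1 / 2 <= _); first by rewrite ler_wpM2r.
rewrite -invfM lef_pV2 ?posrE ?mulr_gt0 ?ltr0Sn // -natrM ler_nat.
by rewrite muln2 -addnn addnS ltnS leq_addr.
Qed.

(* The points where the difference quotients of [F] at [y] exceed [x] (if
   [s = 1]) or fall short of [x] (if [s = -1]) uniformly at scale [1/(n+1)]. *)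
Definition slope_gap {R : realType} (s : R) (F : R -> R) (n : nat) (x y : R) :=
  forall z : R, 0 <= z <= 1 -> `|z - y| < n.+1%:R^-1 ->
    n.+1%:R^-1 * (z - y) ^+ 2 <= s * (F z - F y - x * (z - y)) * (z - y).

(** Near [y] the linearization error uses up at most half of the gap; the other half remains as a
    uniform slope. *)
Lemma slope_gap_exists {R : realType} (F f : R -> R) (s x y : R) :
  differentiates F f -> 0 <= y <= 1 -> `|s| = 1 -> 0 < s * (f y - x) ->
  exists n, slope_gap s F n x y.
Proof.
move=> dF y01 s1 gap.
have gap2 : 0 < s * (f y - x) / 2 by lra.
have [d d0 Hd] := dF y _ y01 gap2.
have [|n] := ltr_invn_exists (Num.min (s * (f y - x) / 2) d).
  by rewrite lt_min gap2.
rewrite lt_min => /andP[n1 nd]; exists n => z z01 zn.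
have {}Hd := Hd z z01 (lt_trans zn nd).
have zy : 0 <= (z - y) ^+ 2 := sqr_ge0 _.
have : `|s * (F z - F y - f y * (z - y)) * (z - y)| <= s * (f y - x) / 2 * (z - y) ^+ 2.
  by rewrite !normrM s1 mul1r -[(z - y) ^+ 2]real_normK ?num_real // expr2 mulrA ler_wpM2r.
rewrite ler_norml => /andP[Hl _].
have Hn : n.+1%:R^-1 * (z - y) ^+ 2 <= s * (f y - x) / 2 * (z - y) ^+ 2.
  by rewrite ler_wpM2r // ltW.
rewrite (le_trans Hn) //.
have -> : s * (F z - F y - x * (z - y)) * (z - y) =
  s * (f y - x) * (z - y) ^+ 2 + s * (F z - F y - f y * (z - y)) * (z - y) by ring.
lra.
Qed.

(** Otherwise every essential subrectangle meets [slope_gap]. In a rectangle narrower than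
    [eta / 2], freezing [x] at the end [be] costs at most half the slope, so strips without steep
    levels have degree 0, and [strip_mass_eq0] makes the whole degree 0. *)
Lemma essential_avoid {R : realType} (F f g : R -> R) (s : R) (n : nat) (r : rect R) :
  differentiates F f -> s = 1 \/ s = -1 -> essential f g r ->
  exists r', [/\ essential f g r', subrect r' r
    & forall x y, in_rect r' x y -> ~ slope_gap s F n x y].
Proof.
move=> dF s1 ess0; apply: contrapT => stuck.
have n0 : 0 < (n.+1%:R : R)^-1 by rewrite invr_gt0 ltr0Sn.
pose eta : R := n.+1%:R^-1.
have delta0 : 0 < eta / 2 by rewrite divr_gt0.
have [r1 [ess sub1 width]] := essential_shrinkx f g r (eta / 2) ess0 delta0.
have meet r' : essential f g r' -> subrect r' r1 ->
    exists x y, in_rect r' x y /\ slope_gap s F n x y.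
  move=> ess' sub'; apply: contrapT => N; apply: stuck; exists r'; split => //.
    exact: subrect_trans sub' sub1.
  by move=> x y xy gap; apply: N; exists x, y.
move: ess => [] {stuck sub1 ess0}.
case: r1 width meet => a b c d /= ab meet ab1 b1 cd d1 /eqP; apply.
(* With this end, [s * (f y - be) > 0] puts [f y] strictly on one side of all of [[a, b]]. *)
pose be := if s == 1 then b else a.
have dP := differentiates_scaleD F f s (- (s * be)) dF.
have HY y := fun y01 fy => steep_near _ _ y (eta / 2) eta dP y01 fy delta0 n0.
have m0 (t u : R) : c <= t -> t <= u -> u <= d ->
    (forall z, t <= z <= u -> ~ (0 <= z <= 1 /\ forall w : R, 0 <= w <= 1 ->
       `|w - z| < eta -> eta / 2 * (w - z) ^+ 2 <=
         (s * F w + - (s * be) * w - (s * F z + - (s * be) * z)) * (w - z))) ->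
    degree f g (Rect a b t u) = 0.
  move=> ct tu ud H; apply/eqP/negPn/negP => N.
  have [||x [y []]] := meet (Rect a b t u).
  - by split => //=; lra.
  - by rewrite /subrect /=; lra.
  rewrite /in_rect /= => /andP[xab yt] gap; apply: (H y) => //; split=> [|w w01 wy]; first lra.
  have sbe : s * (be - x) <= eta / 2.
    rewrite /be; case: s1 => ->; first by rewrite eqxx; lra.
    by rewrite ifF; [lra|apply/eqP; lra].
  have -> : (s * F w + - (s * be) * w - (s * F y + - (s * be) * y)) * (w - y) =
    s * (F w - F y - x * (w - y)) * (w - y) - s * (be - x) * (w - y) ^+ 2 by ring.
  rewrite lerBrDr (le_trans _ (gap w w01 wy)) // -mulrDl ler_wpM2r ?sqr_ge0 //.
  by rewrite -/eta; lra.
(* On levels where [f > b] (resp. [f < a]) the degree of the strip only depends on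
   whether [g] crosses it with [f (g x) < x] (resp. [f (g x) >= x]) at [x = a] and
   at [x = b]. *)
have [sE|sE] := s1.
- have beE : be = b by rewrite /be sE eqxx.
  apply: (strip_mass_eq0 _ _ _ (fun t u => degree f g (Rect a b t u)) c d (g a) (g b)
     (f (g a) < a) (f (g b) < b) dP HY _ _ d1 _ m0); try lra.
  + by move=> t u v; exact: degree_addy.
  + by rewrite beE sE => ? _; lra.
  + by rewrite beE sE => ? _; lra.
  move=> t u ct tu ud; rewrite beE sE => ft fu.
  rewrite /degree /= !turn_left; try lra.
  by rewrite !crossing_count //; ring.
- have beE : be = a by rewrite /be sE ifF //; apply/eqP; lra.
  (* The sides trade places because [turn_right] counts the crossing with a minus sign. *)
  apply: (strip_mass_eq0 _ _ _ (fun t u => degree f g (Rect a b t u)) c d (g b) (g a)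
     (b <= f (g b)) (a <= f (g a)) dP HY _ _ d1 _ m0); try lra.
  + by move=> t u v; exact: degree_addy.
  + by rewrite beE sE => ? _; lra.
  + by rewrite beE sE => ? _; lra.
  move=> t u ct tu ud; rewrite beE sE => ft fu.
  rewrite /degree /= !turn_right; try lra.
  by rewrite !crossing_count //; ring.
Qed.

Lemma essential_step {R : realType} (F G f g : R -> R) (n : nat) (r : rect R) :
  differentiates F f -> differentiates G g -> essential f g r ->
  exists r', [/\ essential f g r', subrect r' r
    & forall x y s, in_rect r' x y -> s = 1 \/ s = -1 ->
        ~ slope_gap s F n x y /\ ~ slope_gap s G n y x].
Proof.
move=> dF dG ess.
have sub_in r1 r2 (x y : R) : subrect r1 r2 -> in_rect r1 x y -> in_rect r2 x y.
  by rewrite /subrect /in_rect => /and4P[? ? ? ?] /andP[? ?]; lra.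
have [r1 [ess1 sub1 H1]] := essential_avoid F f g 1 n r dF (or_introl erefl) ess.
have [r2 [ess2 sub2 H2]] := essential_avoid F f g (-1) n r1 dF (or_intror erefl) ess1.
have [r3 [ess3 sub3 H3]] :=
  essential_avoid G g f 1 n _ dG (or_introl erefl) (essential_flip _ _ _ ess2).
have [r4 [ess4 sub4 H4]] := essential_avoid G g f (-1) n r3 dG (or_intror erefl) ess3.
have sub42 : subrect (flip r4) r2.
  move: (subrect_trans _ _ _ sub4 sub3); rewrite /subrect /=.
  by move=> /and4P[? ? ? ?]; lra.
have flip_in (x y : R) : in_rect (flip r4) x y -> in_rect r4 y x.
  by rewrite /in_rect andbC.
exists (flip r4); split; first exact: essential_flip.
  exact: subrect_trans sub42 (subrect_trans _ _ _ sub2 sub1).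
move=> x y s xy; have xy2 := sub_in _ _ _ _ sub42 xy.
case=> ->; split.
- by apply: H1; exact: sub_in sub2 xy2.
- by apply: H3; apply: sub_in sub4 _; exact: flip_in.
- exact: H2.
- by apply: H4; exact: flip_in.
Qed.

(** * Nested intersection and the fixed point *)

Lemma nested_rects_meet {R : realType} (u : nat -> rect R) :
  (forall n, xl (u n) <= xr (u n)) -> (forall n, yl (u n) <= yr (u n)) ->
  (forall n, subrect (u n.+1) (u n)) ->
  exists x y, forall n, in_rect (u n) x y.
Proof.
move=> ux uy usub.
have sub m n : (m <= n)%N -> subrect (u n) (u m).
  elim: n => [|n IH]; first by rewrite leqn0 => /eqP ->; exact: subrect_refl.
  rewrite leq_eqVlt => /predU1P[->|/IH mn]; first exact: subrect_refl.
  exact: subrect_trans (usub n) mn.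
have meet (a b : nat -> R) : (forall n, a n <= b n) ->
    (forall m n, (m <= n)%N -> a m <= a n /\ b n <= b m) ->
    exists x, forall n, a n <= x <= b n.
  move=> ab mono.
  have amb m n : a m <= b n.
    have [? _] := mono m _ (leq_maxl m n); have [_ ?] := mono n _ (leq_maxr m n).
    by have := ab (maxn m n); lra.
  exists (sup (range a)) => n; apply/andP; split.
    by apply: ub_le_sup; [exists (b 0) => _ [m _ <-]|exists n].
  by apply: ge_sup; [exists (a 0), 0|move=> _ [m _ <-]].
have [|x Hx] := meet (fun n => xl (u n)) (fun n => xr (u n)) ux.
  by move=> m n /sub /and4P[].
have [|y Hy] := meet (fun n => yl (u n)) (fun n => yr (u n)) uy.
  by move=> m n /sub /and4P[].
by exists x, y => n; rewrite /in_rect Hx Hy.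
Qed.

Theorem theorem1 (R : realType) (f g : R -> R)
    (f01 : unit_selfmap f) (g01 : unit_selfmap g)
    (df : unit_derivative f) (dg : unit_derivative g) :
  exists x : R, x \in `[0, 1] /\ f (g x) = x.
Proof.
apply: contrapT => nofix.
have {}nofix (x : R) : 0 <= x <= 1 -> f (g x) <> x.
  by move=> x01 fgx; apply: nofix; exists x; rewrite in_itv.
have [F dF] := differentiates_unit_derivative f df.
have [G dG] := differentiates_unit_derivative g dg.
have ess0 : essential f g (Rect 0 1 0 1).
  by split; rewrite /= ?lexx ?ler01 // degree_unit.
have /choice[step Hstep] (nr : nat * {r | essential f g r}) :
    exists r' : {r | essential f g r}, subrect (sval r') (sval nr.2) /\
      forall x y s, in_rect (sval r') x y -> s = 1 \/ s = -1 ->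
        ~ slope_gap s F nr.1 x y /\ ~ slope_gap s G nr.1 y x.
  case: nr => [n [r ess]] /=.
  have [r' [ess' sub' H]] := essential_step F G f g n r dF dG ess.
  by exists (exist _ r' ess').
pose u := fix u n := if n is m.+1 then step (m, u m) else exist _ _ ess0.
have [|||x [y xy]] := nested_rects_meet (fun n => sval (u n)).
- by move=> n; case: (svalP (u n)) => /andP[].
- by move=> n; case: (svalP (u n)) => _ _ /andP[].
- by move=> n; case: (Hstep (n, u n)).
(* Scale [n] is removed in passing from [u n] to [u n.+1], so the common point avoids every scale
   and neither component of the field can have a sign there. *)
have avoid n s := (Hstep (n, u n)).2 x y s (xy n.+1).
have /andP[x01 y01] : (0 <= x <= 1) && (0 <= y <= 1) := xy 0.
have sgn (t : R) : t != 0 -> exists s : R, (s = 1 \/ s = -1) /\ 0 < s * t.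
  rewrite neq_lt => /orP[t0|t0]; first by exists (-1); split; [right|lra].
  by exists 1; split; [left|lra].
have s1 (s : R) : s = 1 \/ s = -1 -> `|s| = 1 by case=> ->; rewrite ?normrN normr1.
have [/subr0_eq fy|/sgn[s [sE gap]]] := eqVneq (f y - x) 0; last first.
  have [n] := slope_gap_exists F f s x y dF y01 (s1 s sE) gap.
  by case: (avoid n s sE).
have [/subr0_eq gx|/sgn[s [sE gap]]] := eqVneq (g x - y) 0; last first.
  have [n] := slope_gap_exists G g s y x dG x01 (s1 s sE) gap.
  by case: (avoid n s sE).
by apply: (nofix x x01); rewrite gx.
Qed.
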